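(* Let $\omega\in\Omega$, $l\in[n]\setminus\{\pi(\omega)\}$ and $\xi_2\in\{y_{\min},\dots,y_{\max}\}$. Then the inequality $$\theta_\omega\;\geq\;\sum_{\xi_1=y_{\min}}^{y_{\max}}W^\omega_{\pi(\omega)l}(\xi_1,\xi_2)\,z_{\pi(\omega)\xi_1}(y)\;-\;\sum_{\xi'=\xi_2+1}^{y_{\max}}\ \max_{\xi_1\in\{y_{\min},\dots,y_{\max}\}}\Bigl(W^\omega_{\pi(\omega)l}(\xi_1,\xi_2)-W^\omega_{\pi(\omega)l}(\xi_1,\xi')\Bigr)z_{l\xi'}(y)$$ is valid for the master problem; that is, for every $y\in Y$, the value $f_\omega(y)$ is at least the right-hand side, where $z_{j\xi}(y)=1$ if $y_j=\xi$ and $z_{j\xi}(y)=0$ otherwise.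
   Context: Let $n$ be a positive integer, $[n]=\{1,\dots,n\}$, and let $y_{\min}\le y_{\max}$ be non-negative integers. The problem considered is $$\min_y\ g(y)+\sum_{\omega\in\Omega}f_\omega(y)\quad\text{subject to } y\in Y,$$ where $\Omega$ is a finite set, $Y\subseteq\{y_{\min},\dots,y_{\max}\}^n\subseteq\mathbb{Z}_+^n$ is a finite set, $g:\mathbb{Z}_+^n\to\mathbb{R}$ is a function, and for each $\omega\in\Omega$, $f_\omega:\mathbb{Z}_+^n\to\mathbb{R}_+$ is a bounded function that is non-increasing in each of the variables ($\mathbb{Z}_+$, $\mathbb{R}_+$ denote the non-negative integers and reals). A function $\pi:\Omega\to[n]$ is given. In the master problem, each $f_\omega(y)$ is replaced by a continuous variable $\theta_\omega$, and binary variables $z_{j\xi}$ ($j\in[n]$, $\xi\in\{y_{\min},\dots,y_{\max}\}$) are introduced with $z_{j\xi}=1$ if and only if $y_j=\xi$, via the constraints $\sum_{\xi} z_{j\xi}=1$ and $\sum_\xi \xi z_{j\xi}=y_j$ for all $j\in[n]$. For $y\in\mathbb{Z}_+^n$ and $\mathcal{L}\subseteq[n]$, $\Delta(\mathcal{L},y)\in\mathbb{Z}_+^n$ denotes the vector obtained from $y$ by replacing $y_j$ by $y_{\max}$ for all $j\in[n]\setminus\mathcal{L}$. For distinct $k,l\in[n]$ and $\xi_1,\xi_2\in\{y_{\min},\dots,y_{\max}\}$, with $e_j$ the $j$th standard basis vector, $$W^\omega_{kl}(\xi_1,\xi_2)=f_\omega\bigl(\Delta(\{k,l\},\xi_1e_k+\xi_2e_l)\bigr),$$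 i.e. the value of $f_\omega$ when coordinate $k$ is $\xi_1$, coordinate $l$ is $\xi_2$, and all other coordinates are $y_{\max}$. Empty sums are zero. *)

(* Defs.v *)
From HB Require Import structures.
From mathcomp Require Import all_boot all_order all_algebra finmap reals.

Set Implicit Arguments.
Unset Strict Implicit.
Unset Printing Implicit Defensive.

Import Order.TTheory GRing.Theory Num.Theory.
Local Open Scope ring_scope.

(* Vectors of Z_+^n are rows 'rV[nat]_n, and [n] is 'I_n (indices start at 0). *)

Definition nonincreasing_in_each (R : realType) (n : nat)
    (f : 'rV[nat]_n -> R) : Prop :=
  forall (j : 'I_n) (x y : 'rV[nat]_n),
    (forall i : 'I_n, i != j -> x 0 i = y 0 i) ->
    (x 0%R j <= y 0%R j)%N -> f y <= f x.

Definition Delta (n ymax : nat) (L : {set 'I_n}) (y : 'rV[nat]_n) : 'rV[nat]_n :=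
  \row_j (if j \in L then y 0 j else ymax).

Definition W (R : realType) (n ymax : nat) (f : 'rV[nat]_n -> R)
    (k l : 'I_n) (xi1 xi2 : nat) : R :=
  f (Delta ymax [set k; l] (xi1 *: delta_mx 0 k + xi2 *: delta_mx 0 l)).

Definition z (R : realType) (n : nat) (y : 'rV[nat]_n) (j : 'I_n) (xi : nat) : R :=
  (y 0 j == xi)%:R.

(* For lo <= hi the initial value F lo is itself one of the values ranged over,
   so this is exactly the maximum of F over {lo, ..., hi}; no spurious default
   such as 0 enters the maximum. *)
Definition max_range (R : realType) (lo hi : nat) (F : nat -> R) : R :=
  \big[Num.max/F lo]_(lo <= xi < hi.+1) F xi.

(* Main.v *)
Require Import Defs.
From HB Require Import structures.
From mathcomp Require Import all_boot all_order all_algebra finmap reals.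

Set Implicit Arguments.
Unset Strict Implicit.
Unset Printing Implicit Defensive.

Import Order.TTheory GRing.Theory Num.Theory.
Local Open Scope ring_scope.

(** The right-hand side never exceeds [W a b], where [a] and [b] are the entries of
    [y] at [pi w] and [l]; and [W a b] is at most [f w y], because raising every
    other entry of [y] to [ymax] can only decrease [f w] ([W_le]).  Indeed the
    indicators collapse each sum to at most one term ([sum_indicator]), the first
    sum becoming [W a xi2].  If [b <= xi2] the second sum vanishes and
    [W a xi2 <= W a b] by monotonicity.  If [xi2 < b] the second sum is the largest
    possible drop from column [xi2] to column [b], hence at least
    [W a xi2 - W a b]. *)

(** The coordinates are raised from [x] to [y] one at a time, from the left. *)
Lemma nonincreasing_le (R : realType) (n : nat) (f : 'rV[nat]_n -> R)
    (x y : 'rV[nat]_n) :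
  nonincreasing_in_each f -> (forall j, (x 0%R j <= y 0%R j)%N) -> f y <= f x.
Proof.
move=> f_nonincr le_xy.
pose u m : 'rV[nat]_n := \row_j (if (j < m)%N then y 0 j else x 0 j).
have u0 : u 0%N = x by apply/rowP => j; rewrite mxE.
have un : u n = y by apply/rowP => j; rewrite mxE ltn_ord.
rewrite -un; have: (n <= n)%N by [].
elim: {1 3}n => [|m IHm] lt_mn; first by rewrite u0.
apply: le_trans (IHm (ltnW lt_mn)).
apply: (f_nonincr (Ordinal lt_mn)) => [i ne_im|]; rewrite !mxE /=.
  by rewrite ltnS [(i <= m)%N]leq_eqVlt -[_ == m]/(i == Ordinal lt_mn) (negPf ne_im).
by rewrite ltnn ltnSn.
Qed.

Lemma Delta_pairE (n ymax : nat) (k l : 'I_n) (a b : nat) (j : 'I_n) :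
  l != k ->
  (Delta ymax [set k; l] (a *: delta_mx 0 k + b *: delta_mx 0 l)) 0 j
  = if j == k then a else if j == l then b else ymax.
Proof.
move=> ne_lk; rewrite !mxE !inE /=.
have [->|_] := eqVneq j k.
  by rewrite eq_sym (negPf ne_lk) mulr1 mulr0 addr0.
by have [_|//] := eqVneq j l; rewrite mulr0 mulr1 add0r.
Qed.

Lemma W_le (R : realType) (n ymax : nat) (f : 'rV[nat]_n -> R) (k l : 'I_n)
    (y : 'rV[nat]_n) :
  nonincreasing_in_each f -> l != k -> (forall j, (y 0%R j <= ymax)%N) ->
  W ymax f k l (y 0 k) (y 0 l) <= f y.
Proof.
move=> f_nonincr ne_lk y_le; apply: nonincreasing_le => // j.
rewrite Delta_pairE //.
by have [->|_] := eqVneq j k; [|have [->|_] := eqVneq j l].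
Qed.

Lemma W_nonincr_r (R : realType) (n ymax : nat) (f : 'rV[nat]_n -> R)
    (k l : 'I_n) (a b b' : nat) :
  nonincreasing_in_each f -> l != k -> (b <= b')%N ->
  W ymax f k l a b' <= W ymax f k l a b.
Proof.
move=> f_nonincr ne_lk le_bb'; apply: nonincreasing_le => // j.
by rewrite !Delta_pairE //; case: eqP => // _; case: eqP.
Qed.

Lemma sum_indicator (R : realType) (n : nat) (y : 'rV[nat]_n) (j : 'I_n)
    (lo hi : nat) (F : nat -> R) :
  \sum_(lo <= xi < hi) F xi * z R y j xi
  = if (lo <= y 0%R j < hi)%N then F (y 0 j) else 0.
Proof.
rewrite -mem_index_iota; case: ifPn => [y_in|y_notin].
  rewrite (bigD1_seq (y 0 j)) ?iota_uniq //= /z eqxx mulr1 big1 ?addr0 // => i ne_i.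
  by rewrite eq_sym (negPf ne_i) mulr0.
rewrite big_seq big1 // => i i_in; rewrite /z.
by case: eqP i_in y_notin => [->->//|_ _ _]; rewrite mulr0.
Qed.

Lemma le_max_range (R : realType) (lo hi xi : nat) (F : nat -> R) :
  (lo <= xi <= hi)%N -> F xi <= max_range lo hi F.
Proof.
move=> xi_in; apply: (@le_bigmax_seq _ _ _ _ _ xi predT F) => //.
by rewrite mem_index_iota ltnS.
Qed.

Theorem mainTheorem5 (R : realType) (n : nat) (n_gt0 : (0 < n)%N)
    (ymin ymax : nat) (le_ymin_ymax : (ymin <= ymax)%N)
    (Omega : finType)
    (Y : {fset 'rV[nat]_n})
    (Y_box : forall y : 'rV[nat]_n, y \in Y ->
       forall j : 'I_n, (ymin <= y 0%R j <= ymax)%N)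
    (g : 'rV[nat]_n -> R)
    (f : Omega -> 'rV[nat]_n -> R)
    (f_ge0 : forall (w : Omega) (y : 'rV[nat]_n), 0 <= f w y)
    (f_bounded : forall w : Omega, exists M : R,
       forall y : 'rV[nat]_n, `|f w y| <= M)
    (f_nonincr : forall w : Omega, nonincreasing_in_each (f w))
    (pi : Omega -> 'I_n)
    (w : Omega) (l : 'I_n) (l_neq_pi : l != pi w)
    (xi2 : nat) (xi2_range : (ymin <= xi2 <= ymax)%N) :
  forall y : 'rV[nat]_n, y \in Y ->
    f w y >=
      \sum_(ymin <= xi1 < ymax.+1)
         W ymax (f w) (pi w) l xi1 xi2 * z R y (pi w) xi1
      - \sum_(xi2.+1 <= xi' < ymax.+1)
           max_range ymin ymax
             (fun xi1 => W ymax (f w) (pi w) l xi1 xi2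
                         - W ymax (f w) (pi w) l xi1 xi')
           * z R y l xi'.
Proof.
move=> y yY; have y_box := Y_box y yY.
have y_le j : (y 0%R j <= ymax)%N by case/andP: (y_box j).
apply: le_trans (W_le (f_nonincr w) l_neq_pi y_le).
rewrite !sum_indicator !ltnS y_box y_le andbT.
case: ltnP => [_|le_b_xi2]; last by rewrite subr0; apply: W_nonincr_r.
rewrite lerBlDl -lerBlDr.
exact: (@le_max_range R ymin ymax (y 0 (pi w))
  (fun a => W ymax (f w) (pi w) l a xi2 - W ymax (f w) (pi w) l a (y 0 l))).
Qed.
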